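(* Let $\Phi(x,z)=(xz+1)^{-1}x\in\mathbb{Q}\langle\langle x,z\rangle\rangle$. For every $n$-component $F$-link $L$ in $S^3$, $$\chi_\Phi(L)=-\overline{\chi_\Phi(L)} .$$
   Context: Rings. $F$ is the free group on $t_1,\dots,t_n$, $\Lambda=\mathbb{Q}[F]$, and $\hat\Lambda$ is its completion with respect to powers of the augmentation ideal, identified with $\mathbb{Q}\langle\langle x_1,\dots,x_n\rangle\rangle$ (noncommuting variables $x_i=t_i-1$). $\overline{\phantom{a}}$ is the anti-involution of $\hat\Lambda$ with $\bar g=g^{-1}$ for $g\in F$, so $\bar x_i=-(1+x_i)^{-1}x_i$. $M'$ denotes the transpose of $M$. $F$-links and Seifert matrices. An $F$-link of $n$ components is an oriented link $L\subset S^3$ (up to isotopy) with a homomorphism (splitting map) $\phi:\pi_1(S^3\setminus L)\to F$ sending a choice of meridians to the basis $t_1,\dots,t_n$. $\mathrm{Sei}(n)$ is the set of square integer matrices $A=(A_{ij})_{1\le i,j\le n}$ partitioned into $n\times n$ blocks (square diagonal blocks of arbitrary sizes) such that $A_{ij}'=A_{ji}$ for $i\ne j$ and $\det(A_{ii}-A_{ii}')=1$ for all $i$; put $Z_A=A(A-A')^{-1}$. $L$ has disjoint connected oriented Seifert surfaces $\Sigma_1,\dots,\Sigma_n$ with $\partial\Sigma_i=L_i$ inducing $\phi$ (a loop is sent to the word in the $t_i^{\pm1}$ recording its successive signed crossings with the $\Sigma_i$). With bases of the $H_1(\Sigma_i,\mathbb{Z})$, the matrix of linking numbers $\mathrm{lk}(a^+,b)$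 (basis elements $a,b$; $a^+$ the positive push-off) is a Seifert matrix $A\in\mathrm{Sei}(n)$ of $L$. The invariants $\chi_f$. $f\in\mathbb{Q}\langle\langle x,z\rangle\rangle$ is admissible if for every $m\ge 0$ it has only finitely many terms of total $x$-degree $m$ ($\Phi$ is admissible). For admissible $f$ and $A\in\mathrm{Sei}(n)$, $\chi_f(A)=\mathrm{tr}(f(X,Z_A)-f(X,I_{1/2}))\in\hat\Lambda$, where $X=\mathrm{diag}(x_1,\dots,x_n)$ is block diagonal with the block sizes of $A$ and $i$-th block $x_i$ times the identity, and $I_{1/2}$ is a diagonal matrix of the same size with, in each diagonal block, half of the diagonal entries $0$ and half $1$. $\chi_f(L):=\chi_f(A)$ for any Seifert matrix $A$ of $L$ (independent of choices). *)

(* Defs.v *)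
From HB Require Import structures.
From mathcomp Require Import all_boot all_order all_algebra.
From mathcomp Require Import all_classical all_reals all_analysis.

Set Implicit Arguments.
Unset Strict Implicit.
Unset Printing Implicit Defensive.

Import Order.TTheory GRing.Theory Num.Theory.
Import numFieldNormedType.Exports.

Local Open Scope classical_set_scope.
Local Open Scope ring_scope.

(* Noncommutative formal power series with rational coefficients over an
   alphabet T: a series is its coefficient function on words. *)
Record ncps (T : Type) := NCPS { ncoef : seq T -> rat }.

HB.instance Definition _ T := gen_eqMixin (ncps T).
HB.instance Definition _ T := gen_choiceMixin (ncps T).

Lemma ncpsP T (f g : ncps T) : ncoef f =1 ncoef g -> f = g.
Proof. by case: f g => [f] [g] /= fg; congr NCPS; apply/funext. Qed.

Definition nc0 T : ncps T := NCPS (fun _ => 0).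
Definition nc1 T : ncps T := NCPS (fun w => (nilp w)%:R).
Definition ncX (T : eqType) (a : T) : ncps T := NCPS (fun w => (w == [:: a])%:R).
Definition ncopp T (f : ncps T) := NCPS (fun w => - ncoef f w).
Definition ncadd T (f g : ncps T) := NCPS (fun w => ncoef f w + ncoef g w).
Definition ncmul T (f g : ncps T) := NCPS (fun w =>
  \sum_(i < (size w).+1) ncoef f (take i w) * ncoef g (drop i w)).

Section NcpsRing.
Context {T : Type}.
Implicit Types (f g h : ncps T) (w : seq T).

Fact ncaddA : associative (@ncadd T).
Proof. by move=> f g h; apply: ncpsP => w /=; rewrite addrA. Qed.
Fact ncaddC : commutative (@ncadd T).
Proof. by move=> f g; apply: ncpsP => w /=; rewrite addrC. Qed.
Fact ncadd0 : left_id (nc0 T) (@ncadd T).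
Proof. by move=> f; apply: ncpsP => w /=; rewrite add0r. Qed.
Fact ncaddN : left_inverse (nc0 T) (@ncopp T) (@ncadd T).
Proof. by move=> f; apply: ncpsP => w /=; rewrite addNr. Qed.

HB.instance Definition _ :=
  GRing.isZmodule.Build (ncps T) ncaddA ncaddC ncadd0 ncaddN.

Let shift (a : T) f := NCPS (fun w => ncoef f (a :: w)).

Let ncmul_nil f g : ncoef (ncmul f g) [::] = ncoef f [::] * ncoef g [::].
Proof. by rewrite /= big_ord1. Qed.

Let ncmul_cons f g a w : ncoef (ncmul f g) (a :: w) =
  ncoef f [::] * ncoef g (a :: w) + ncoef (ncmul (shift a f) g) w.
Proof. by rewrite /= big_ord_recl. Qed.

Let coefD f g w : ncoef (f + g) w = ncoef f w + ncoef g w. Proof. by []. Qed.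

Fact ncmulDl : left_distributive (@ncmul T) +%R.
Proof.
move=> f g h; apply: ncpsP => w /=.
by rewrite -big_split; apply: eq_bigr => i _; rewrite /= mulrDl.
Qed.

Fact ncmulDr : right_distributive (@ncmul T) +%R.
Proof.
move=> f g h; apply: ncpsP => w /=.
by rewrite -big_split; apply: eq_bigr => i _; rewrite /= mulrDr.
Qed.

Let scale (c : rat) f := NCPS (fun w => c * ncoef f w).

Let ncmul_scale c f g : ncmul (scale c f) g = scale c (ncmul f g).
Proof.
by apply: ncpsP => w /=; rewrite mulr_sumr; apply: eq_bigr => i _; rewrite mulrA.
Qed.

Fact ncmulA : associative (@ncmul T).
Proof.
move=> f g h; apply: ncpsP => w; elim: w f g h => [|a w IHw] f g h.
  by rewrite !ncmul_nil mulrA.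
rewrite !ncmul_cons IHw -[LHS]/(_ + ncoef _ _).
have -> : shift a (ncmul f g) =
    scale (ncoef f [::]) (shift a g) + ncmul (shift a f) g.
  by apply: ncpsP => v; rewrite [LHS]ncmul_cons.
rewrite ncmulDl coefD ncmul_scale ncmul_nil mulrDr !mulrA addrA.
by [].
Qed.

Fact ncmul1 : left_id (nc1 T) (@ncmul T).
Proof.
move=> f; apply: ncpsP => -[|a w]; first by rewrite ncmul_nil mul1r.
rewrite ncmul_cons mul1r /= big1 ?addr0 // => i _.
by rewrite mul0r.
Qed.

Fact ncmulr1 : right_id (nc1 T) (@ncmul T).
Proof.
move=> f; apply: ncpsP => w; elim: w f => [|a w IHw] f.
  by rewrite ncmul_nil mulr1.
by rewrite ncmul_cons IHw mulr0 add0r.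
Qed.

Fact nc1_neq0 : nc1 T != 0.
Proof.
by apply/eqP => /(congr1 (fun f => ncoef f [::])) /eqP; rewrite oner_eq0.
Qed.

HB.instance Definition _ := GRing.Zmodule_isNzRing.Build (ncps T)
  ncmulA ncmul1 ncmulr1 ncmulDl ncmulDr nc1_neq0.

End NcpsRing.

(* A series with nonzero constant term c is c * (1 - h) with h of positive
   order, and its inverse is the geometric series (sum_k h^k) / c, in which only
   the k <= size w contribute to the coefficient of w. *)
Definition ncunit T : pred (ncps T) := [pred f | ncoef f [::] != 0].
Definition ncinv T (f : ncps T) : ncps T :=
  let c := ncoef f [::] in
  let h : ncps T := NCPS (fun w => (nilp w)%:R - ncoef f w / c) in
  if f \in @ncunit T then
    NCPS (fun w => (\sum_(k < (size w).+1) ncoef (h ^+ k) w) / c)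
  else f.

Section NcpsInverse.
Context {T : Type}.
Implicit Types (f g h : ncps T) (w : seq T).

Let coef_sum I (r : seq I) (F : I -> ncps T) w :
  ncoef (\sum_(i <- r) F i) w = \sum_(i <- r) ncoef (F i) w.
Proof. by elim/big_rec2: _ => // i _ y _ <-. Qed.

Let coefM f g w : ncoef (f * g) w =
  \sum_(i < (size w).+1) ncoef f (take i w) * ncoef g (drop i w).
Proof. by []. Qed.

Let order_exp h k w : ncoef h [::] = 0 -> (size w < k)%N -> ncoef (h ^+ k) w = 0.
Proof.
move=> h0; elim: k w => // k IHk w; rewrite ltnS => wk.
rewrite exprS coefM big1 // => -[[|i] /= ltiw] _; first by rewrite take0 h0 mul0r.
rewrite IHk ?mulr0 // size_drop; apply: leq_trans wk.
by rewrite ltn_subLR // addSn ltnS leq_addl.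
Qed.

Let cst (c : rat) : ncps T := NCPS (fun w => c * (nilp w)%:R).

Let cstM c f w : ncoef (cst c * f) w = c * ncoef f w.
Proof.
rewrite coefM big_ord_recl /= take0 drop0 mulr1 big1 ?addr0 // => i _.
by case: w i => [[]|a w i] //=; rewrite mulr0 mul0r.
Qed.

Let Mcst c f w : ncoef (f * cst c) w = ncoef f w * c.
Proof.
rewrite coefM big_ord_recr /= take_size drop_size mulr1 big1 ?add0r // => i _.
suff -> : nilp (drop i w) = false by rewrite !mulr0.
by rewrite /nilp size_drop subn_eq0 leqNgt ltn_ord.
Qed.

Let ncinvE f (N : nat) w : f \in @ncunit T -> (size w < N)%N ->
  let c := ncoef f [::] in
  let h : ncps T := NCPS (fun w => (nilp w)%:R - ncoef f w / c) in
  ncoef (ncinv f) w = ncoef ((\sum_(k < N) h ^+ k) * cst c^-1) w.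
Proof.
move=> uf wN c h; rewrite Mcst coef_sum /ncinv uf /=; congr (_ * _).
rewrite -(big_mkord xpredT (fun k => ncoef (h ^+ k) w)).
rewrite -(big_mkord xpredT (fun k => ncoef (h ^+ k) w)).
rewrite (big_cat_nat _ wN) //= -[LHS]addr0; congr (_ + _); symmetry.
rewrite big_nat_cond big1 // => k /andP[/andP[wk _] _]; apply: order_exp => //=.
by rewrite divff ?subrr.
Qed.

Let fE f : f \in @ncunit T ->
  let c := ncoef f [::] in
  let h : ncps T := NCPS (fun w => (nilp w)%:R - ncoef f w / c) in
  f = cst c * (1 - h) /\ ncoef h [::] = 0.
Proof.
move=> uf c h; have c0 : c != 0 by [].
split; last by rewrite /= divff ?subrr.
apply: ncpsP => w; rewrite cstM /= opprB addrC subrK mulrC divfK //.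
Qed.

Let cstK c : c != 0 -> cst c * cst c^-1 = 1.
Proof. by move=> c0; apply: ncpsP => w; rewrite cstM /= mulrA divff ?mul1r. Qed.

Let geom h N : (1 - h) * (\sum_(k < N) h ^+ k) = 1 - h ^+ N.
Proof. by rewrite -opprB mulNr -subrX1 opprB. Qed.

Fact ncmulVr : {in @ncunit T, left_inverse 1 (@ncinv T) *%R}.
Proof.
move=> f uf; pose c := ncoef f [::].
pose h : ncps T := NCPS (fun w => (nilp w)%:R - ncoef f w / c).
have [Ef h0] : f = cst c * (1 - h) /\ ncoef h [::] = 0 := fE uf.
apply: ncpsP => w; pose N := (size w).+1.
have c0 : c != 0 by [].
transitivity (ncoef ((\sum_(k < N) h ^+ k) * cst c^-1 * f) w).
  rewrite !coefM; apply: eq_bigr => i _; congr (_ * _); apply: ncinvE => //.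
  by rewrite /N ltnS size_take_min geq_minr.
rewrite Ef -mulrA (mulrA (cst _)) -{2}[c]invrK cstK ?invr_eq0 // mul1r.
have -> : (\sum_(k < N) h ^+ k) * (1 - h) = 1 - h ^+ N.
  rewrite -geom; apply/commr_sym/commr_sum => i _.
  by apply/commrX/commr_sym/commrB; [exact: commr1|].
by rewrite /= order_exp ?subr0.
Qed.

Fact ncdivrr : {in @ncunit T, right_inverse 1 (@ncinv T) *%R}.
Proof.
move=> f uf; pose c := ncoef f [::].
pose h : ncps T := NCPS (fun w => (nilp w)%:R - ncoef f w / c).
have [Ef h0] : f = cst c * (1 - h) /\ ncoef h [::] = 0 := fE uf.
apply: ncpsP => w; pose N := (size w).+1.
have c0 : c != 0 by [].
transitivity (ncoef (f * ((\sum_(k < N) h ^+ k) * cst c^-1)) w).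
  rewrite !coefM; apply: eq_bigr => i _; congr (_ * _); apply: ncinvE => //.
  by rewrite /N ltnS size_drop leq_subr.
have cC g : cst c * g = g * cst c.
  by apply: ncpsP => v; rewrite cstM Mcst mulrC.
rewrite Ef !mulrA -(mulrA (cst c)) geom cC -mulrA cstK // mulr1.
by rewrite /= order_exp ?subr0.
Qed.

Fact ncunitP f g : g * f = 1 /\ f * g = 1 -> @ncunit T f.
Proof.
move=> [/(congr1 (fun f => ncoef f [::]))]; rewrite coefM big_ord1 /= => gf _.
by apply: contra_eq_neq gf => ->; rewrite mulr0 eq_sym oner_neq0.
Qed.

Fact ncinv_out : {in [predC @ncunit T], @ncinv T =1 id}.
Proof. by move=> f; rewrite inE /ncinv => /negPf ->. Qed.

HB.instance Definition _ := GRing.NzRing_hasMulInverse.Build (ncps T)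
  ncmulVr ncdivrr ncunitP ncinv_out.

End NcpsInverse.


(* The infinite sum of the f_w F_w, coefficient by coefficient.  The finitely
   supported sum \sum_(w \in _) is 0 on an infinite support; below, only finitely
   many words w contribute to each coefficient, because F_w has order at least
   size w (in ncbar), or at least the number of x's in w, with f admissible (in
   nceval). *)
Definition ncsum (T : choiceType) U (f : ncps T) (F : seq T -> ncps U) : ncps U :=
  NCPS (fun u => \sum_(w \in [set: seq T]) ncoef f w * ncoef (F w) u).

(* The completed group ring of the free group on the t_i, with x_i = t_i - 1. *)
Definition Lambda n := ncps 'I_n.

(* The continuous anti-involution that inverts the t_i, hence sends
   x_i to -(1 + x_i)^-1 x_i. *)
Definition ncbar n (f : Lambda n) : Lambda n :=
  ncsum f (fun w => \prod_(i <- rev w) - ((1 + ncX i)^-1 * ncX i)).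

(* Index rows and columns by pairs (block i, position in 'I_(d i)) through the
   block structure of 'I_(\sum_i d i); submxblock A i j is the block A_ij. *)
Definition Sei n (d : 'I_n -> nat) (A : 'M[int]_(\sum_i d i)) :=
  (forall i j, i != j -> (submxblock A i j)^T = submxblock A j i) /\
  (forall i, \det (submxblock A i i - (submxblock A i i)^T) = 1).

Definition Xmx n (d : 'I_n -> nat) : 'M[Lambda n]_(\sum_i d i) :=
  \mxdiag_i (ncX i)%:M.

Definition Zmx n (d : 'I_n -> nat) (A : 'M[int]_(\sum_i d i)) :
    'M[Lambda n]_(\sum_i d i) :=
  map_mx intr (A *m invmx (A - A^T)).

(* The diagonal blocks of a matrix in Sei have even size d i; here the first half
   of the diagonal of each block is 0 and the second half 1.  Another choice of
   the halves permutes the diagonal entries inside the blocks, which changes no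
   trace below. *)
Definition Ihalf n (d : 'I_n -> nat) : 'M[Lambda n]_(\sum_i d i) :=
  \mxdiag_i diag_mx (\row_(k < d i) ((d i)./2 <= k)%:R).

(* Series in x and z: the letter false is x and the letter true is z. *)
Definition nc_x : ncps bool := ncX false.
Definition nc_z : ncps bool := ncX true.

Definition nceval n N (f : ncps bool) (X Z : 'M[Lambda n]_N) : 'M[Lambda n]_N :=
  \matrix_(p, q) ncsum f (fun w =>
    (\big[mulmx/1%:M]_(a <- w) (if a then Z else X)) p q).

Definition chi n (d : 'I_n -> nat) (f : ncps bool) (A : 'M[int]_(\sum_i d i)) :
    Lambda n :=
  \tr (nceval f (Xmx d) (Zmx A) - nceval f (Xmx d) (Ihalf d)).

Definition Phi : ncps bool := (nc_x * nc_z + 1)^-1 * nc_x.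

(* The free group on t_0, ..., t_(n-1), as the group of reduced words: the
   letter (i, true) is t_i and (i, false) is its inverse. *)
Definition fg_letter n := ('I_n * bool)%type.
Definition fg_opp n (a : fg_letter n) : fg_letter n := (a.1, ~~ a.2).
Definition fg_reduced n (w : seq (fg_letter n)) :=
  sorted (fun a b => b != fg_opp a) w.

Record free_group n := FreeGroup {
  fg_word :> seq (fg_letter n);
  fg_word_reduced : fg_reduced fg_word
}.
HB.instance Definition _ n := [isSub for @fg_word n].
HB.instance Definition _ n := [Choice of free_group n by <:].

Section FreeGroup.
Context {n : nat}.
Implicit Types (a b : fg_letter n) (u v w : seq (fg_letter n)).

Fact fg_oppK : involutive (@fg_opp n).
Proof. by case=> i e; rewrite /fg_opp /= negbK. Qed.

Definition fg_cons a w :=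
  if w is b :: w' then if b == fg_opp a then w' else a :: w else [:: a].
Definition fg_cat u v := foldr fg_cons v u.

Fact fg_cons_reduced a w : fg_reduced w -> fg_reduced (fg_cons a w).
Proof.
case: w => //= b w; case: eqP => [_|/eqP ba /= rw]; first by case: w => //= c w /andP[].
by rewrite ba.
Qed.

Fact fg_consK a w : fg_reduced w -> fg_cons a (fg_cons (fg_opp a) w) = w.
Proof.
case: w => [|b w] /=; first by rewrite eqxx.
rewrite fg_oppK; case: (eqVneq b a) => [->|_] /=; last by rewrite eqxx.
by case: w => //= c w /andP[/negPf ->].
Qed.

Fact fg_cat_reduced u v : fg_reduced v -> fg_reduced (fg_cat u v).
Proof. by move=> rv; elim: u => //= a u; exact: fg_cons_reduced. Qed.

Fact fg_cons_id a w : fg_reduced (a :: w) -> fg_cons a w = a :: w.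
Proof. by case: w => //= b w /andP[/negPf ->]. Qed.

Fact fg_cats0 u : fg_reduced u -> fg_cat u [::] = u.
Proof.
elim: u => //= a u IHu rau; rewrite IHu ?fg_cons_id //.
by move: rau; rewrite /fg_reduced /=; exact: path_sorted.
Qed.

Fact fg_catA u v w : fg_reduced v -> fg_reduced w ->
  fg_cat u (fg_cat v w) = fg_cat (fg_cat u v) w.
Proof.
move=> rv rw; elim: u => //= a u ->.
have := fg_cat_reduced u rv; case: (fg_cat u v) => //= b s.
case: eqP => [-> rs|//]; rewrite fg_consK //; exact: fg_cat_reduced.
Qed.

Definition fg_inv u := rev [seq fg_opp a | a <- u].

Fact fg_inv_reduced u : fg_reduced u -> fg_reduced (fg_inv u).
Proof.
rewrite /fg_reduced /fg_inv rev_sorted sorted_map; apply: sub_sorted => a b /=.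
by rewrite fg_oppK eq_sym.
Qed.

Fact fg_catVs u : fg_reduced u -> fg_cat (fg_inv u) u = [::].
Proof.
elim: u => //= a u IHu rau; rewrite /fg_inv /= rev_cons /fg_cat foldr_rcons /=.
rewrite fg_oppK eqxx; apply: IHu.
by move: rau; rewrite /fg_reduced /=; exact: path_sorted.
Qed.

Definition fgM (u v : free_group n) : free_group n :=
  FreeGroup (fg_cat_reduced u (fg_word_reduced v)).
Definition fg1 : free_group n := @FreeGroup n [::] isT.
Definition fgV (u : free_group n) : free_group n :=
  FreeGroup (fg_inv_reduced (fg_word_reduced u)).

Fact fgMA : associative fgM.
Proof. by move=> u v w; apply/val_inj/fg_catA; exact: fg_word_reduced. Qed.
Fact fg1M : left_id fg1 fgM.
Proof. by move=> u; exact/val_inj. Qed.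
Fact fgM1 : right_id fg1 fgM.
Proof. by move=> u; apply/val_inj/fg_cats0; exact: fg_word_reduced. Qed.
Fact fgVM : left_inverse fg1 fgV fgM.
Proof. by move=> u; apply/val_inj/fg_catVs; exact: fg_word_reduced. Qed.
Fact fgMV : right_inverse fg1 fgV fgM.
Proof.
move=> u; rewrite -{1}[u](_ : fgV (fgV u) = u) ?fgVM //; apply/val_inj.
by rewrite /= /fg_inv map_rev revK mapK //; exact: fg_oppK.
Qed.

HB.instance Definition _ :=
  isGroup.Build (free_group n) fgMA fg1M fgM1 fgVM fgMV.

Definition fg_gen (i : 'I_n) : free_group n := @FreeGroup n [:: (i, true)] isT.

End FreeGroup.

(* Links in S^3 and their Seifert surfaces are isotoped off the point at infinity
   and live in R^3 = 'rV[R]_3.  All closed curves are 1-periodic functions on R. *)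
Definition dot (R : realType) (u v : 'rV[R]_3) : R := \sum_i u 0 i * v 0 i.
Definition enorm (R : realType) (u : 'rV[R]_3) : R := Num.sqrt (dot u u).
Definition triple (R : realType) (u v w : 'rV[R]_3) : R :=
  \det (\matrix_(k < 3) [:: u; v; w]`_k).

Definition velocity (R : realType) (c : R -> 'rV[R]_3) : R -> 'rV[R]_3 :=
  (c^`())%classic.

Definition smooth_curve (R : realType) (c : R -> 'rV[R]_3) :=
  forall k t, derivable ((c^`(k))%classic) t 1.

(* C^oo: all iterated directional derivatives exist and are continuous. *)
Definition smooth_fun (R : realType) (f : 'rV[R]_3 -> R) :=
  forall s : seq 'rV[R]_3,
    let g := foldr (fun v h => 'D_v h) f s in
    continuous g /\ forall p v, derivable g p v.

Definition grad (R : realType) (f : 'rV[R]_3 -> R) (p : 'rV[R]_3) : 'rV[R]_3 :=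
  \row_i 'D_(delta_mx 0 i) f p.

Definition periodic1 (R : realType) (T : Type) (c : R -> T) :=
  forall t, c (t + 1) = c t.

(* Gauss's integral, normalized so that a meridian circling its link component
   by the right-hand rule has linking number 1 with it. *)
Definition linking (R : realType) (a b : R -> 'rV[R]_3) : R :=
  (4 * pi)^-1 *
  \int[lebesgue_measure]_(s in `[0, 1]) \int[lebesgue_measure]_(t in `[0, 1])
    (triple (velocity a s) (velocity b t) (a s - b t) / enorm (a s - b t) ^+ 3).

Record link (R : realType) (n : nat) := Link {
  link_comp :> 'I_n -> R -> 'rV[R]_3;
  link_smooth : forall i, smooth_curve (link_comp i);
  link_periodic : forall i, periodic1 (link_comp i);
  link_regular : forall i t, velocity (link_comp i) t != 0;
  link_embedded : forall i j s t, link_comp i s = link_comp j t ->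
    i = j /\ exists k : int, s - t = k%:~R
}.

Definition complement (R : realType) n (L : link R n) : set 'rV[R]_3 :=
  [set p | forall i t, p != L i t].

Definition loop_in (R : realType) (C : set 'rV[R]_3) (c : R -> 'rV[R]_3) :=
  [/\ continuous c, periodic1 c & forall t, C (c t)].

Definition freely_homotopic (R : realType) (C : set 'rV[R]_3)
    (c0 c1 : R -> 'rV[R]_3) :=
  exists H : R -> R -> 'rV[R]_3,
    [/\ continuous (fun p : R * R => H p.1 p.2), forall s, loop_in C (H s),
        H 0 = c0 & H 1 = c1].

Definition homotopic (R : realType) (C : set 'rV[R]_3) (b : 'rV[R]_3)
    (c0 c1 : R -> 'rV[R]_3) :=
  exists H : R -> R -> 'rV[R]_3,
    [/\ continuous (fun p : R * R => H p.1 p.2),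
        forall s, loop_in C (H s) /\ H s 0 = b,
        H 0 = c0 & H 1 = c1].

(* c runs through c0 on [0, 1/2], then through c1 on [1/2, 1]. *)
Definition concatenation (R : realType) (c0 c1 c : R -> 'rV[R]_3) :=
  forall t, 0 <= t <= 1 ->
    c (t / 2) = c0 t /\ c ((1 + t) / 2) = c1 t.

(* c is freely homotopic, off the link, to the boundary of a round disc orthogonal
   to L_i that meets the link in its centre only, oriented by the right-hand
   rule. *)
Definition meridian (R : realType) n (L : link R n) (i : 'I_n)
    (c : R -> 'rV[R]_3) :=
  exists (t r : R) (u v : 'rV[R]_3),
    let disc (rho theta : R) :=
      L i t + rho *: (cos (2 * pi * theta) *: u + sin (2 * pi * theta) *: v) in
    [/\ 0 < r,
        [/\ dot u u = 1, dot v v = 1 & dot u v = 0] /\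
        [/\ dot u (velocity (L i) t) = 0, dot v (velocity (L i) t) = 0
          & 0 < triple (velocity (L i) t) u v],
        forall rho theta, 0 < rho <= r -> complement L (disc rho theta)
      & freely_homotopic (complement L) c (disc r)].

(* A link with a homomorphism from the fundamental group of its complement, given
   on the loops based at flink_base (the values of flink_split on other functions
   are irrelevant), that sends a choice of meridians to the basis of the free
   group. *)
Record flink (R : realType) (n : nat) := FLink {
  flink_link :> link R n;
  flink_base : 'rV[R]_3;
  flink_base_out : complement flink_link flink_base;
  flink_split : (R -> 'rV[R]_3) -> free_group n;
  flink_splitH : forall c0 c1,
    homotopic (complement flink_link) flink_base c0 c1 ->
    flink_split c0 = flink_split c1;
  flink_splitM : forall c0 c1 c,
    loop_in (complement flink_link) c0 -> c0 0 = flink_base ->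
    loop_in (complement flink_link) c1 -> c1 0 = flink_base ->
    loop_in (complement flink_link) c -> concatenation c0 c1 c ->
    flink_split c = (flink_split c0 * flink_split c1)%g;
  flink_split_meridian : forall i, exists c,
    [/\ loop_in (complement flink_link) c, c 0 = flink_base,
        meridian flink_link i c & flink_split c = fg_gen i]
}.

(* nu restricts to the positive unit normal of the zero set of f in U. *)
Definition oriented_chart (R : realType) (S U : set 'rV[R]_3)
    (nu : 'rV[R]_3 -> 'rV[R]_3) (f : 'rV[R]_3 -> R) :=
  smooth_fun f /\ forall p, U p -> S p ->
    grad f p != 0 /\ nu p = (enorm (grad f p))^-1 *: grad f p.

(* A compact connected smooth surface with boundary l, oriented by the unit normal
   nu: near an interior point it is a regular level set f = 0, near a boundary
   point it is the part 0 <= g of one, bounded by g = 0.  As grad g points inwards,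
   the last condition says that l traverses the boundary in the direction induced
   by the orientation (outward vector first), and it makes grad f and grad g
   linearly independent. *)
Definition seifert_surface (R : realType) (l : R -> 'rV[R]_3)
    (S : set 'rV[R]_3) (nu : 'rV[R]_3 -> 'rV[R]_3) :=
  [/\ compact S, connected S, range l `<=` S,
      forall p, S p -> ~ range l p -> exists U f,
        [/\ open_nbhs p U, oriented_chart S U nu f
          & S `&` U = [set q | f q = 0] `&` U]
    & forall p, range l p -> exists U f g,
        [/\ open_nbhs p U, oriented_chart S U nu f /\ smooth_fun g,
            S `&` U = [set q | f q = 0 /\ 0 <= g q] `&` U,
            range l `&` U = [set q | f q = 0 /\ g q = 0] `&` U
          & forall t, U (l t) ->
              0 < triple (velocity l t) (grad g (l t)) (grad f (l t))]].

(* x lists in increasing order the times at which c, transverse to the surfaces,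
   meets them; the entry (t, (i, e)) says that c crosses S_i at time t, in the
   direction of nu_i if e is true and against it otherwise. *)
Definition crossings (R : realType) n (S : 'I_n -> set 'rV[R]_3)
    (nu : 'I_n -> 'rV[R]_3 -> 'rV[R]_3) (c : R -> 'rV[R]_3)
    (x : seq (R * ('I_n * bool))) :=
  [/\ sorted <%R [seq y.1 | y <- x],
      forall t, 0 <= t <= 1 ->
        (exists i, S i (c t)) <-> t \in [seq y.1 | y <- x]
    & forall t i e, (t, (i, e)) \in x ->
        [/\ 0 <= t <= 1, S i (c t)
          & 0 < (-1) ^+ (~~ e) * dot (velocity c t) (nu i (c t))]].

Definition induces (R : realType) n (L : flink R n) (S : 'I_n -> set 'rV[R]_3)
    (nu : 'I_n -> 'rV[R]_3 -> 'rV[R]_3) :=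
  (forall i, ~ S i (flink_base L)) /\
  forall c x, smooth_curve c -> loop_in (complement L) c ->
    c 0 = flink_base L -> crossings S nu c x ->
    flink_split L c =
      (\prod_(y <- x) (if y.2.2 then fg_gen y.2.1 else (fg_gen y.2.1)^-1))%g.

(* Singular chains, as lists of simplices with coefficients.  A singular 1-simplex
   is the restriction to [0, 1] of a function on R, and a singular 2-simplex the
   restriction of a function on the plane to the standard triangle; same_chain is
   equality in the free abelian group on the singular 1-simplices. *)
Definition chain (T : Type) := seq (int * T).

Definition same_chain (R : realType) (x y : chain (R -> 'rV[R]_3)) :=
  let coef (z : chain (R -> 'rV[R]_3)) (c : R -> 'rV[R]_3) : int :=
    \sum_(a <- z | `[< forall t, 0 <= t <= 1 -> a.2 t = c t >]) a.1 in
  forall c, coef x c = coef y c.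

Definition simplex1 (R : realType) (S : set 'rV[R]_3) (c : R -> 'rV[R]_3) :=
  {within `[0, 1], continuous c} /\ forall t, 0 <= t <= 1 -> S (c t).

Definition triangle (R : realType) : set (R * R) :=
  [set p | [/\ 0 <= p.1, 0 <= p.2 & p.1 + p.2 <= 1]].

Definition simplex2 (R : realType) (S : set 'rV[R]_3)
    (s : R * R -> 'rV[R]_3) :=
  {within @triangle R, continuous s} /\ forall p, @triangle R p -> S (s p).

Definition cycle1 (R : realType) (S : set 'rV[R]_3)
    (z : chain (R -> 'rV[R]_3)) :=
  (forall a, a \in z -> simplex1 S a.2) /\
  forall p, \sum_(a <- z) a.1 * ((a.2 1 == p)%:R - (a.2 0 == p)%:R) = 0.

Definition boundary2 (R : realType) (y : chain (R * R -> 'rV[R]_3)) :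
    chain (R -> 'rV[R]_3) :=
  flatten [seq [:: (a.1, fun t => a.2 (1 - t, t)); (- a.1, fun t => a.2 (0, t));
                   (a.1, fun t => a.2 (t, 0))] | a <- y].

Definition homologous (R : realType) (S : set 'rV[R]_3)
    (x y : chain (R -> 'rV[R]_3)) :=
  exists2 b : chain (R * R -> 'rV[R]_3),
    forall a, a \in b -> simplex2 S a.2 & same_chain x (y ++ boundary2 b).

(* The classes of the loops a_k form a basis of the singular homology H_1(S; Z). *)
Definition H1_basis (R : realType) (S : set 'rV[R]_3) m
    (a : 'I_m -> R -> 'rV[R]_3) :=
  (forall k, loop_in S (a k)) /\
  forall z, cycle1 S z -> exists! c : {ffun 'I_m -> int},
    homologous S z [seq (c k, a k) | k <- enum 'I_m].

(* The rows and columns of the block A_ij are indexed by bases a_i and a_j of H_1 of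
   the surfaces S_i and S_j, with entries lk(a_i k ^+, a_j l); the push-off is
   a_i k + e nu_i for all small e > 0.  That this matrix of linking numbers belongs
   to Sei is a property of linking numbers which holds for all such data; it is
   recorded here as part of the definition of a Seifert matrix. *)
Definition seifert_matrix (R : realType) n (L : flink R n) (d : 'I_n -> nat)
    (A : 'M[int]_(\sum_i d i)) :=
  Sei A /\
  exists (S : 'I_n -> set 'rV[R]_3) (nu : 'I_n -> 'rV[R]_3 -> 'rV[R]_3)
         (a : forall i, 'I_(d i) -> R -> 'rV[R]_3),
    [/\ forall i, seifert_surface (L i) (S i) (nu i),
        forall i j, i != j -> S i `&` S j = set0,
        induces L S nu,
        forall i, H1_basis (S i) (a i) /\ forall k, smooth_curve (a i k)
      & forall i j k l, \forall e \near 0^'+,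
          linking (fun t => a i k t + e *: nu i (a i k t)) (a j l) =
          (submxblock A i j k l)%:~R].

(* Main.v *)
From HB Require Import structures.
Require Import Defs.
From mathcomp Require Import all_boot all_order all_algebra.
From mathcomp Require Import all_classical all_reals all_analysis.

(** The antisymmetry comes from the self-duality of a Seifert matrix [A]: passing
    from [A] to its transpose replaces [Z = Z_A] by [1 - Z] up to conjugation, and
    the substitution [z |-> 1 - z], [x |-> bar x] changes [Phi] into its opposite.

    Write [M^H] for the bar-conjugate transpose of a matrix over the completed
    group ring; it reverses products because bar is an anti-involution.  The
    matrix [E = Phi(X, Z)] is the only solution of [(1 + XZ)E = X], and so [E^H]
    solves [E^H(1 + Z'X^H) = X^H], where [X^H(1 + X) = -X] because
    [bar x_i = -(1 + x_i)^-1 x_i].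

    Put [S = A - A'].  From [Z = A S^-1] and [S' = -S] one computes
    [S Z' S^-1 = 1 - Z].  The matching conditions [A_ij' = A_ji] make [S] block
    diagonal, so that the integer matrix [S] commutes with [X] and [X^H].  Hence
    [F = S E^H S^-1] has the trace [bar (tr E)], and it satisfies
    [F(1 + (1 - Z)X^H) = X^H].  Multiplying by [1 + X] on the right, and using
    [(1 + (1 - Z)X^H)(1 + X) = 1 + ZX], gives [F(1 + ZX) = -X].  Therefore
    [(1 + XZ)(E + F)(1 + ZX) = X(1 + ZX) - (1 + XZ)X = 0], and [F = -E] because
    both outer factors are cancellable: [X] has positive order.  This is
    [tr_nceval_Phi_bar].

    The correction term [tr Phi(X, I_1/2)] is antisymmetric for the same reason.
    The blocks of [A] have even size, an odd skew-symmetric determinant being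
    zero; so the permutation that reverses every block exchanges the two halves
    of the diagonal of [I_1/2], and can play the part of [S]. *)

Set Implicit Arguments.
Unset Strict Implicit.

Import GRing.Theory.
Local Open Scope ring_scope.

(** * Coefficients and orders of noncommutative power series *)

Section Series.
Context {T : Type}.
Implicit Types (f g h : ncps T) (w u : seq T) (a : T) (N : nat).

Lemma ncoefM f g w : ncoef (f * g) w =
  \sum_(i < (size w).+1) ncoef f (take i w) * ncoef g (drop i w).
Proof. by []. Qed.

Lemma ncoefD f g w : ncoef (f + g) w = ncoef f w + ncoef g w.
Proof. by []. Qed.

Lemma ncoef_sum I (r : seq I) (F : I -> ncps T) w :
  ncoef (\sum_(i <- r) F i) w = \sum_(i <- r) ncoef (F i) w.
Proof. by elim/big_rec2: _ => // i _ y _ <-. Qed.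

Definition ncC (c : rat) : ncps T := NCPS (fun w => c * (nilp w)%:R).

Lemma ncoef_Cmul c f w : ncoef (ncC c * f) w = c * ncoef f w.
Proof.
rewrite ncoefM big_ord_recl /= take0 drop0 mulr1 big1 ?addr0 // => i _.
by case: w i => [[]|a w i] //=; rewrite mulr0 mul0r.
Qed.

Lemma ncC_comm c f : f * ncC c = ncC c * f.
Proof.
apply: ncpsP => w; rewrite ncoef_Cmul ncoefM big_ord_recr /= take_size drop_size.
rewrite mulr1 big1 ?add0r 1?mulrC // => i _.
suff -> : nilp (drop i w) = false by rewrite !mulr0.
by rewrite /nilp size_drop subn_eq0 leqNgt ltn_ord.
Qed.

Lemma ncCM c e : ncC (c * e) = ncC c * ncC e.
Proof. by apply: ncpsP => w; rewrite ncoef_Cmul /= mulrA. Qed.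

(** The tail of the decomposition of [f] as its constant term plus the sum of the
    [x_a * ncshift a f]: the device for inductions on words. *)
Definition ncshift a f : ncps T := NCPS (fun w => ncoef f (a :: w)).

Lemma ncshiftM a f g :
  ncshift a (f * g) = ncC (ncoef f [::]) * ncshift a g + ncshift a f * g.
Proof.
apply: ncpsP => w; rewrite ncoefD ncoef_Cmul.
by rewrite -[LHS]/(ncoef (f * g) (a :: w)) ncoefM big_ord_recl.
Qed.

Definition order_ge N f := forall w, (size w < N)%N -> ncoef f w = 0.

Lemma order_ge0 f : order_ge 0 f. Proof. by []. Qed.

Lemma order_geD N f g : order_ge N f -> order_ge N g -> order_ge N (f + g).
Proof. by move=> Nf Ng w wN; rewrite /= Nf // Ng // addr0. Qed.

Lemma order_geN N f : order_ge N f -> order_ge N (- f).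
Proof. by move=> Nf w wN; rewrite /= Nf // oppr0. Qed.

Lemma order_ge_sum N I (r : seq I) (F : I -> ncps T) :
  (forall i, order_ge N (F i)) -> order_ge N (\sum_(i <- r) F i).
Proof. by move=> NF w wN; rewrite ncoef_sum big1 // => i _; apply: NF. Qed.

Lemma order_geM M N f g : order_ge M f -> order_ge N g -> order_ge (M + N) (f * g).
Proof.
move=> Mf Ng w wMN; rewrite ncoefM big1 // => -[i /=]; rewrite ltnS => iw _.
have [iM|Mi] := ltnP i M.
  by rewrite Mf ?mul0r // size_take_min (leq_ltn_trans (geq_minl _ _)).
rewrite Ng ?mulr0 // size_drop ltn_subLR // (leq_trans wMN) //.
by rewrite leq_add2r.
Qed.

(** Series are separated by their orders, which turns every identity below into
    one that can be proved degree by degree. *)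
Lemma order_ge_eq f g : (forall N, order_ge N (f - g)) -> f = g.
Proof.
move=> fg; apply: ncpsP => w; apply/eqP; rewrite -subr_eq0; apply/eqP.
exact: (fg (size w).+1).
Qed.

End Series.

Lemma ncoef_Xmul (A : eqType) (a : A) (f : ncps A) w :
  ncoef (ncX a * f) w = if w is b :: w' then (b == a)%:R * ncoef f w' else 0.
Proof.
case: w => [|b w]; first by rewrite ncoefM big_ord1 /= mul0r.
rewrite ncoefM big_ord_recl /= mul0r add0r big_ord_recl /= take0 drop0 eqseq_cons.
rewrite andbT big1 ?addr0 // => i _; rewrite eqseq_cons.
case: w i => [[]|c w i] //=; by rewrite andbF mul0r.
Qed.

(** An infinite sum of series is finite in each coefficient as soon as a finite
    list of words is known to carry it. *)
Lemma ncsumE (A : choiceType) U (f : ncps A) (F : seq A -> ncps U) (r : seq (seq A))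
  (u : seq U) :
  uniq r -> (forall w, w \notin r -> ncoef f w * ncoef (F w) u = 0) ->
  ncoef (ncsum f F) u = \sum_(w <- r) ncoef f w * ncoef (F w) u.
Proof.
move=> ur fF0; rewrite /= (@fsbigE _ _ _ _ _ r) //; last by move=> w _; exact: fF0.
by apply: eq_bigl => w; rewrite in_setT.
Qed.

(** * The anti-involution *)

Section Bar.
Context {n : nat}.
Implicit Types (f g : Lambda n) (w u : seq 'I_n) (i : 'I_n).

(** The words shorter than [N], which determine [ncbar] up to order [N]. *)
Fixpoint short_words N : seq (seq 'I_n) :=
  if N is N'.+1 then [::] :: [seq i :: w | i <- enum 'I_n, w <- short_words N'] else [::].

Lemma mem_short_words N w : (w \in short_words N) = (size w < N)%N.
Proof.
elim: N w => [|N IHN] [|i w] //=; rewrite inE /= ltnS -IHN.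
apply/allpairsP/idP => [[[j v] /= [_ vN [_ ->]]] //|wN].
by exists (i, w); rewrite /= mem_enum.
Qed.

Lemma uniq_short_words N : uniq (short_words N).
Proof.
elim: N => //= N IHN; apply/andP; split; first by apply/allpairsP => -[[i w] /= []].
by apply: allpairs_uniq => //; [exact: enum_uniq|move=> [i w] [j v] _ _ /= [-> ->]].
Qed.

Definition xbar i : Lambda n := - ((1 + ncX i)^-1 * ncX i).

Lemma unit_1DX i : (1 + ncX i : Lambda n) \is a GRing.unit.
Proof. by rewrite -[X in is_true X]/(1 + 0 != 0 :> rat) addr0 oner_eq0. Qed.

Lemma xbarM i : xbar i * (1 + ncX i) = - ncX i.
Proof.
have XC : ncX i * (1 + ncX i) = (1 + ncX i) * ncX i by rewrite mulrDr mulrDl mulr1 mul1r.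
by rewrite mulNr -mulrA XC mulKr // unit_1DX.
Qed.

Lemma order_X i : order_ge 1 (ncX i : Lambda n).
Proof. by case. Qed.

Lemma order_xbar i : order_ge 1 (xbar i).
Proof. exact/order_geN/(order_geM (order_ge0 _))/order_X. Qed.

Definition barword w : Lambda n := \prod_(i <- rev w) xbar i.

Lemma barword_cons i w : barword (i :: w) = barword w * xbar i.
Proof. by rewrite /barword rev_cons big_rcons. Qed.

Lemma order_barword w : order_ge (size w) (barword w).
Proof.
elim: w => [|i w IHw]; first exact: order_ge0.
by rewrite barword_cons /= -addn1; apply: order_geM; last exact: order_xbar.
Qed.

(** The factors of [barword w] have positive order, so a word at least as long as
    [N] cannot contribute to a coefficient of length less than [N]. *)
Lemma ncoef_ncbar N f u : (size u < N)%N ->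
  ncoef (ncbar f) u = \sum_(w <- short_words N) ncoef f w * ncoef (barword w) u.
Proof.
move=> uN; apply: ncsumE; first exact: uniq_short_words.
move=> w; rewrite mem_short_words -leqNgt => Nw.
by rewrite [X in _ * X](order_barword (leq_trans uN Nw)) mulr0.
Qed.

Lemma ncbarD f g : ncbar (f + g) = ncbar f + ncbar g.
Proof.
apply: ncpsP => u; rewrite ncoefD !(@ncoef_ncbar (size u).+1) //.
by rewrite -big_split; apply: eq_bigr => w _; rewrite /= mulrDl.
Qed.

Lemma ncbarCM c f : ncbar (ncC c * f) = ncC c * ncbar f.
Proof.
apply: ncpsP => u; rewrite ncoef_Cmul !(@ncoef_ncbar (size u).+1) // mulr_sumr.
by apply: eq_bigr => w _; rewrite ncoef_Cmul mulrA.
Qed.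

Lemma ncbar_is_zmod_morphism : zmod_morphism (@ncbar n).
Proof.
move=> f g; apply: (addIr (ncbar g)).
by rewrite -ncbarD !subrK.
Qed.
HB.instance Definition _ :=
  GRing.isZmodMorphism.Build (Lambda n) (Lambda n) (@ncbar n) ncbar_is_zmod_morphism.

(** Grouping the words by their first letter; this letter comes last in the
    reversed product. *)
Lemma ncbar_shift f :
  ncbar f = ncC (ncoef f [::]) + \sum_i ncbar (ncshift i f) * xbar i.
Proof.
apply: ncpsP => u; pose N := (size u).+1.
rewrite (@ncoef_ncbar N.+1) // big_cons big_allpairs_dep /= /barword big_nil ncoef_sum.
congr (_ + _); rewrite big_enum; apply: eq_bigr => i _.
rewrite ncoefM; under [RHS]eq_bigr => k _.
  rewrite (@ncoef_ncbar N) ?mulr_suml; last first.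
    by rewrite ltnS size_take_min geq_minr.
  over.
rewrite exchange_big; apply: eq_bigr => w _ /=.
rewrite -/(barword (i :: w)) barword_cons ncoefM mulr_sumr.
by apply: eq_bigr => k _; rewrite mulrA.
Qed.

Lemma ncbar1 : ncbar (1 : Lambda n) = 1.
Proof.
rewrite ncbar_shift big1 => [|i _].
  by rewrite addr0; apply: ncpsP => w; rewrite /= mul1r.
have -> : ncshift i 1 = 0 :> Lambda n by apply: ncpsP.
by rewrite raddf0 mul0r.
Qed.

(** By induction on the order to which the two sides agree: after expanding along
    first letters, the terms with the constant coefficient of [f] cancel, and the
    others carry a factor [xbar i], which raises the order by one. *)
Lemma ncbarM f g : ncbar (f * g) = ncbar g * ncbar f.
Proof.
apply: order_ge_eq => N; elim: N f g => [|N IHN] f g; first exact: order_ge0.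
have -> : ncbar (f * g) - ncbar g * ncbar f =
    \sum_i (ncbar (ncshift i f * g) - ncbar g * ncbar (ncshift i f)) * xbar i.
  have -> : ncbar (f * g) = ncC (ncoef f [::]) * ncbar g +
      \sum_i ncbar (ncshift i f * g) * xbar i.
    rewrite ncbar_shift [ncbar g]ncbar_shift mulrDr -ncCM ncoefM big_ord1 -addrA.
    congr (_ + _); rewrite mulr_sumr -big_split; apply: eq_bigr => i _.
    by rewrite ncshiftM raddfD /= ncbarCM mulrDl mulrA.
  rewrite [ncbar f]ncbar_shift mulrDr ncC_comm mulr_sumr opprD addrACA subrr add0r.
  by rewrite -sumrB; apply: eq_bigr => i _; rewrite mulrBl mulrA.
by apply: order_ge_sum => i; rewrite -addn1; apply: order_geM (order_xbar i).
Qed.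

Lemma ncbar_X i : ncbar (ncX i) = xbar i.
Proof.
have E j : ncshift j (ncX i) = (j == i)%:R :> Lambda n.
  by apply: ncpsP => w; rewrite /= eqseq_cons; case: eqP => _ /=; case: w.
have -> : ncbar (ncX i) = \sum_j (j == i)%:R * xbar j.
  rewrite ncbar_shift (_ : ncC _ = 0) ?add0r; last first.
    by apply: ncpsP => w; rewrite /= mul0r.
  by apply: eq_bigr => j _; rewrite E; case: eqP; rewrite ?ncbar1 ?raddf0.
rewrite (bigD1 i) //= eqxx mul1r big1 ?addr0 // => j /negPf->.
by rewrite mul0r.
Qed.

End Bar.

(** * The coefficients of Phi *)

Section PhiCoef.

(** The words [(xz)^k x], which carry [Phi]: expanding the geometric series,
    [Phi] is the sum of the [(-1)^k (xz)^k x]. *)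
Fixpoint xzx k : seq bool := if k is k'.+1 then [:: false, true & xzx k'] else [:: false].

Lemma size_xzx k : size (xzx k) = k.*2.+1.
Proof. by elim: k => //= k ->. Qed.

Lemma xzx_inj : injective xzx.
Proof.
by move=> k l /(congr1 size); rewrite !size_xzx => -[/double_inj].
Qed.

Lemma Phi_fix : Phi = nc_x - nc_x * (nc_z * Phi).
Proof.
have u : nc_x * nc_z + 1 \is a GRing.unit.
  by rewrite -[X in is_true X]/(\sum_(i < 1) _ + 1 != 0 :> rat) big_ord1 mul0r.
apply/eqP; rewrite eq_sym subr_eq -{1}(mulVKr u nc_x) -/Phi mulrDl mul1r.
by rewrite addrC mulrA.
Qed.

Lemma ncoef_Phi w : ncoef Phi w =
  match w with
  | [:: false] => 1
  | [:: false, true & w'] => - ncoef Phi w'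
  | _ => 0
  end.
Proof.
have Xmul (a : bool) (f : ncps bool) v : ncoef (ncX a * f) v =
    if v is b :: v' then (b == a)%:R * ncoef f v' else 0 by exact: ncoef_Xmul.
rewrite {1}Phi_fix ncoefD -[ncoef (- _) w]/(- ncoef _ w) Xmul.
case: w => [|[] [|[] w]]; rewrite ?Xmul /= ?mul0r ?mul1r ?mulr0 ?oppr0 ?addr0 ?add0r //.
Qed.

Lemma ncoef_Phi_xzx k : ncoef Phi (xzx k) = (-1) ^+ k.
Proof.
elim: k => [|k IHk]; rewrite ncoef_Phi //.
by rewrite -[LHS]/(- ncoef Phi (xzx k)) IHk exprS mulN1r.
Qed.

Lemma Phi_support w : ncoef Phi w != 0 -> exists k, w = xzx k.
Proof.
have [m] := ubnP (size w); elim: m w => // m IHm w wm; rewrite ncoef_Phi.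
case: w wm => [|[] [|[] w]] wm; rewrite ?eqxx //; first by exists 0%N.
rewrite oppr_eq0 => /IHm[|k ->]; last by exists k.+1.
exact: ltnW.
Qed.

End PhiCoef.

(** * Matrices of power series *)

Section Mx.
Context {n N : nat}.
Implicit Types (M P X Z : 'M[Lambda n]_N) (S T : 'M[int]_N).

Definition mx_order_ge k M := forall p q, order_ge k (M p q).

Lemma mx_order_geD k M P : mx_order_ge k M -> mx_order_ge k P -> mx_order_ge k (M + P).
Proof. by move=> kM kP p q; rewrite mxE; apply: order_geD. Qed.

Lemma mx_order_geN k M : mx_order_ge k M -> mx_order_ge k (- M).
Proof. by move=> kM p q; rewrite mxE; apply: order_geN. Qed.

Lemma mx_order_geM k l M P :
  mx_order_ge k M -> mx_order_ge l P -> mx_order_ge (k + l) (M *m P).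
Proof. by move=> kM lP p q; rewrite mxE; apply: order_ge_sum => r; apply: order_geM. Qed.

Lemma mx_order_ge0 M : mx_order_ge 0 M.
Proof. by move=> p q; apply: order_ge0. Qed.

Lemma mx_order_ge_eq M P : (forall k, mx_order_ge k (M - P)) -> M = P.
Proof.
move=> MP; apply/matrixP => p q; apply: order_ge_eq => k.
by have := MP k p q; rewrite !mxE.
Qed.

(** A fixed point of a map that raises orders has infinite order. *)
Lemma contract_eq0 (f : 'M[Lambda n]_N -> 'M[Lambda n]_N) M :
  (forall k P, mx_order_ge k P -> mx_order_ge k.+1 (f P)) -> f M = M -> M = 0.
Proof.
move=> fk fM; apply: mx_order_ge_eq => k; rewrite subr0.
by elim: k => [|k /fk]; rewrite ?fM //; exact: mx_order_ge0.
Qed.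

Section Cancel.
Context (X Z : 'M[Lambda n]_N) (X1 : mx_order_ge 1 X).

(** With the next lemma: [1 + XZ] cancels on the left and [1 + ZX] on the right.
    Cancelling on one side is all that the proof asks of the geometric series that
    invert them. *)
Lemma add1_mulXZ_cancel M : M + X *m (Z *m M) = 0 -> M = 0.
Proof.
move=> eqM; apply: (@contract_eq0 (fun P => - (X *m (Z *m P)))).
  by move=> k P kP; apply/mx_order_geN/(mx_order_geM X1)/(mx_order_geM (mx_order_ge0 Z)).
by apply/esym/eqP; rewrite -addr_eq0 eqM.
Qed.

Lemma add1_mulZX_cancel M : M + M *m Z *m X = 0 -> M = 0.
Proof.
move=> eqM; apply: (@contract_eq0 (fun P => - (P *m Z *m X))).
  move=> k P kP; apply/mx_order_geN; rewrite -addn1; apply: mx_order_geM X1.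
  by rewrite -(addn0 k); apply: mx_order_geM => //; apply: mx_order_ge0.
by apply/esym/eqP; rewrite -addr_eq0 eqM.
Qed.

Let wordmx w : 'M[Lambda n]_N := \big[mulmx/1%:M]_(a <- w) (if a then Z else X).

Let wordmx_cons a w : wordmx (a :: w) = (if a then Z else X) *m wordmx w.
Proof. by rewrite /wordmx big_cons. Qed.

Let wordmx1 : wordmx [:: false] = X.
Proof. by rewrite wordmx_cons /wordmx big_nil mulmx1. Qed.

Let order_wordmx k : mx_order_ge k.+1 (wordmx (xzx k)).
Proof.
elim: k => [|k IHk]; first by rewrite wordmx1.
rewrite /= !wordmx_cons -add1n; apply: mx_order_geM X1 _.
exact: mx_order_geM (mx_order_ge0 Z) IHk.
Qed.

(** The truncations of the geometric series of [Phi(X, Z)]. *)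
Let partial k : 'M[Lambda n]_N := \sum_(i < k) (-1) ^+ i *: wordmx (xzx i).

Let partialS k : partial k.+1 = X - X *m (Z *m partial k).
Proof.
rewrite /partial big_ord_recl /= scale1r wordmx1; congr (_ + _).
rewrite !mulmx_sumr -sumrN; apply: eq_bigr => i _; rewrite -/(wordmx _) /=.
rewrite !wordmx_cons exprS mulN1r scaleNr; congr (- _).
by rewrite -signr_odd; case: odd; rewrite ?scaleN1r ?scale1r ?mulmxN.
Qed.

(** The word [(xz)^i x] has [i + 1] letters [x], so its value has order more than
    [i], and the words with [k <= i] do not matter up to order [k]. *)
Let nceval_partial k : mx_order_ge k (nceval Phi X Z - partial k).
Proof.
move=> p q u uk; rewrite 2!mxE ncoefD [X in _ + ncoef X _]mxE.
rewrite -[ncoef (- _) u]/(- ncoef _ u); apply/eqP; rewrite subr_eq0; apply/eqP.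
rewrite (@ncsumE _ _ _ _ [seq xzx i | i <- index_iota 0 k]).
- rewrite big_map /partial summxE ncoef_sum big_mkord.
  apply: eq_bigr => i _; rewrite ncoef_Phi_xzx mxE -/(wordmx _) -signr_odd
    -[in RHS]signr_odd.
  by case: odd; rewrite ?mulN1r ?mul1r.
- by rewrite map_inj_uniq ?iota_uniq //; exact: xzx_inj.
move=> w wk; have [->|/Phi_support[i Ew]] := eqVneq (ncoef Phi w) 0.
  by rewrite mul0r.
rewrite [X in _ * X](_ : _ = 0) ?mulr0 // Ew; apply: order_wordmx.
rewrite ltnS (leq_trans (ltnW uk)) // leqNgt; apply: contra wk => ik.
by rewrite Ew map_f // mem_index_iota.
Qed.

(** The limit of the recursion [partial k.+1 = X - X Z (partial k)] between the
    truncations. *)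
Lemma nceval_Phi : nceval Phi X Z + X *m (Z *m nceval Phi X Z) = X.
Proof.
set E := nceval Phi X Z; apply: mx_order_ge_eq => k.
have -> : E + X *m (Z *m E) - X =
    (E - partial k.+1) + X *m (Z *m (E - partial k)).
  rewrite partialS !mulmxBr opprB; set a := X *m (Z *m E); set b := X *m _.
  by rewrite addrACA [b - X - b]addrAC subrr sub0r.
apply: mx_order_geD.
  by move=> p q u uk; apply: nceval_partial; exact: ltnW.
by apply: (mx_order_geM (mx_order_ge0 X)); apply: (mx_order_geM (mx_order_ge0 Z)).
Qed.

End Cancel.

(** The conjugate transpose [M^H]. *)
Definition mxbar M : 'M[Lambda n]_N := map_mx (@ncbar n) M^T.

Lemma mxbarD M P : mxbar (M + P) = mxbar M + mxbar P.
Proof. by rewrite /mxbar linearD map_mxD. Qed.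

Lemma mxbarM M P : mxbar (M *m P) = mxbar P *m mxbar M.
Proof.
apply/matrixP => p q; rewrite !mxE raddf_sum; apply: eq_bigr => r _.
by rewrite /= !mxE ncbarM.
Qed.

Lemma mxtrace_bar M : \tr (mxbar M) = ncbar (\tr M).
Proof. by rewrite raddf_sum; apply: eq_bigr => p _; rewrite !mxE. Qed.

Definition intmx S : 'M[Lambda n]_N := map_mx intr S.

Lemma ncbar_int (m : int) : ncbar (m%:~R : Lambda n) = m%:~R.
Proof. by rewrite raddfMz /= ncbar1. Qed.

Lemma mxbar_int S : mxbar (intmx S) = intmx S^T.
Proof. by apply/matrixP => p q; rewrite !mxE ncbar_int. Qed.

(** Traces of products commute when the entries of one factor are central. *)
Lemma mxtrace_mul_intC S M : \tr (intmx S *m M) = \tr (M *m intmx S).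
Proof.
rewrite /mxtrace; under eq_bigr => p _ do rewrite mxE.
rewrite exchange_big; apply: eq_bigr => q _; rewrite mxE; apply: eq_bigr => p _.
by rewrite mxE; apply/esym/commr_int.
Qed.

End Mx.

(** * The trace of Phi under the anti-involution *)

Section Antisymmetry.
Context {n : nat} (d : 'I_n -> nat).
Local Notation N := (\sum_i d i)%N.
Implicit Types (S T Z : 'M[int]_N).

Lemma XmxE : Xmx d = diag_mx (\row_p ncX (tagnat.sig1 p)).
Proof.
rewrite /Xmx; under eq_mxdiag => i do rewrite -diag_const_mx.
by rewrite -diag_mxrow; congr diag_mx; apply/rowP => p; rewrite !mxE.
Qed.

Lemma order_Xmx : mx_order_ge 1 (Xmx d).
Proof.
move=> p q; rewrite XmxE !mxE; case: eqP => _; first exact: order_X.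
by move=> w _; rewrite mulr0n.
Qed.

Lemma mxbar_X : mxbar (Xmx d) = diag_mx (\row_p xbar (tagnat.sig1 p)).
Proof.
rewrite /mxbar XmxE tr_diag_mx; apply/matrixP => p q.
by rewrite !mxE raddfMn /= ncbar_X.
Qed.

Lemma mxbar_XM : mxbar (Xmx d) *m (1%:M + Xmx d) = - Xmx d.
Proof.
rewrite mxbar_X mulmxDr mulmx1 XmxE mulmx_diag -!raddfD -raddfN /=; congr diag_mx.
by apply/rowP => p; rewrite !mxE -xbarM mulrDr mulr1.
Qed.

Definition block_diagonal S := forall p q, tagnat.sig1 p != tagnat.sig1 q -> S p q = 0.

Lemma block_diagonal_comm S : block_diagonal S ->
  mxbar (Xmx d) *m intmx S = intmx S *m mxbar (Xmx d).
Proof.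
move=> Sd; rewrite mxbar_X; apply/matrixP => p q.
rewrite mul_diag_mx mul_mx_diag !mxE.
have [->|/Sd->] := eqVneq (tagnat.sig1 p) (tagnat.sig1 q); last by rewrite mulr0 mul0r.
exact: commr_int.
Qed.

(** The heart of the proof: whenever a block-diagonal invertible integer matrix [S]
    intertwines [Z'] and [1 - Z], conjugating [E^H] by [S] gives a matrix [F] with
    the trace [ncbar (\tr E)] which is squeezed to [- E] between two cancellable
    factors. *)
Lemma tr_nceval_Phi_bar Z S T : block_diagonal S -> S *m T = 1%:M ->
  S *m Z^T = (1%:M - Z) *m S ->
  \tr (nceval Phi (Xmx d) (intmx Z)) = - ncbar (\tr (nceval Phi (Xmx d) (intmx Z))).
Proof.
move=> Sd ST SZ; set X := Xmx d; set z := intmx Z; set E := nceval _ _ _.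
have TS : T *m S = 1%:M by exact: mulmx1C.
pose s : 'M[Lambda n]_N := intmx S; pose t : 'M[Lambda n]_N := intmx T.
have st : s *m t = 1%:M by rewrite -map_mxM ST map_mx1.
have ts : t *m s = 1%:M by rewrite -map_mxM TS map_mx1.
pose Xb := mxbar X; pose Eb := mxbar E; pose F := s *m Eb *m t.
have sX : Xb *m s = s *m Xb by exact: block_diagonal_comm.
have tX : t *m Xb = Xb *m t.
  by rewrite -[Xb in LHS]mulmx1 -st (mulmxA Xb) sX !mulmxA ts mul1mx.
have szt : s *m mxbar z *m t = 1%:M - z.
  by rewrite mxbar_int -map_mxM SZ map_mxM -mulmxA st mulmx1 map_mxB map_mx1.
have eqE : E + X *m (z *m E) = X by exact: nceval_Phi (order_Xmx).
have eqEb : Eb + Eb *m mxbar z *m Xb = Xb.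
  by rewrite -[RHS](congr1 mxbar eqE) mxbarD !mxbarM.
have eqF : F + F *m (1%:M - z) *m Xb = Xb.
  have -> : F *m (1%:M - z) *m Xb = s *m (Eb *m mxbar z *m Xb) *m t.
    by rewrite -szt /F !mulmxA -(mulmxA _ t s) ts mulmx1 -!(mulmxA _ t) tX !mulmxA.
  by rewrite /F -mulmxDl -mulmxDr eqEb -sX -mulmxA st mulmx1.
(* The previous equation multiplied by 1 + X on the right. *)
have {eqF} eqF : F + F *m z *m X = - X.
  rewrite -mxbar_XM -/Xb -[in RHS]eqF mulmxDl -[F *m _ *m _ *m _]mulmxA mxbar_XM.
  rewrite mulmxDr mulmx1 mulmxN mulmxBr mulmx1 mulmxBl opprB.
  by rewrite -addrA subrKC.
suff FE : F = - E.
  have -> : ncbar (\tr E) = \tr F.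
    by rewrite /F -mulmxA mxtrace_mul_intC -mulmxA ts mulmx1 mxtrace_bar.
  by rewrite FE raddfN opprK.
apply/eqP; rewrite -addr_eq0; apply/eqP.
apply: (@add1_mulZX_cancel _ _ X z (order_Xmx)).
apply: (@add1_mulXZ_cancel _ _ X z (order_Xmx)).
(* (E + F)(1 + ZX) = E(1 + ZX) - X by eqF, and 1 + XZ times this is 0 by eqE. *)
have -> : F + E + (F + E) *m z *m X = E + E *m z *m X - X.
  by rewrite 2!mulmxDl addrACA eqF addrC.
have -> : E + E *m z *m X - X + X *m (z *m (E + E *m z *m X - X)) =
    (E + X *m (z *m E)) + (E + X *m (z *m E)) *m z *m X - (X + X *m z *m X).
  rewrite !mulmxBr !mulmxDr !mulmxDl !mulmxA opprD addrACA; congr (_ + _).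
  by rewrite addrACA.
by rewrite eqE subrr.
Qed.

End Antisymmetry.

(** * Seifert matrices *)

Section Sei.
Context {n : nat} {d : 'I_n -> nat}.
Local Notation N := (\sum_i d i)%N.

Lemma mxdiag_submxblock (S : 'M[int]_N) : block_diagonal S ->
  S = \mxdiag_i submxblock S i i.
Proof.
move=> Sd; rewrite -[LHS]submxblockK; apply/eq_mxblockP => i j.
have [<-|ij] := eqVneq i j; first by rewrite conform_mx_id.
by apply/matrixP => k l; rewrite !mxE Sd // !tagnat.Rank1K.
Qed.

Lemma mul_mxdiag (B C : forall i, 'M[int]_(d i)) :
  (\mxdiag_i B i) *m (\mxdiag_i C i) = \mxdiag_i (B i *m C i).
Proof.
rewrite mul_mxdiag_mxblock; apply/eq_mxblockP => i j.
have [<-|_] := eqVneq i j; last by rewrite mulmx0.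
by rewrite !conform_mx_id.
Qed.

Context {A : 'M[int]_N} (SeiA : Sei A).

Lemma Sei_block_diagonal : block_diagonal (A - A^T).
Proof.
move=> p q pq; have /matrixP/(_ (tagnat.sig2 q) (tagnat.sig2 p)) := SeiA.1 _ _ pq.
by rewrite !mxE !tagnat.sig2K => ->; rewrite subrr.
Qed.

Lemma submxblock_alt i :
  submxblock (A - A^T) i i = submxblock A i i - (submxblock A i i)^T.
Proof. by apply/matrixP => k l; rewrite !mxE. Qed.

(** The inverse can be taken block by block, where the determinant is 1. *)
Lemma Sei_unit : A - A^T \in unitmx.
Proof.
set S := A - A^T.
suff /mulmx1_unit[] : S *m (\mxdiag_i invmx (submxblock S i i)) = 1%:M by [].
rewrite [S in S *m _](mxdiag_submxblock Sei_block_diagonal) mul_mxdiag -mxdiagZ.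
apply/eq_mxdiagP => i; apply: mulmxV.
by rewrite unitmxE submxblock_alt SeiA.2.
Qed.

(** Transposition multiplies a skew-symmetric determinant of odd size by -1, so it
    vanishes and cannot be 1. *)
Lemma Sei_even i : ~~ odd (d i).
Proof.
have := SeiA.2 i; set B := _ - _ => detB; apply/negP => di.
have : \det B = - \det B.
  rewrite -{1}det_tr linearB /= trmxK -opprB -scaleN1r detZ -signr_odd di.
  by rewrite expr1 mulN1r.
by rewrite detB.
Qed.

(** [S = A - A'] is the intertwiner: [S Z' = - A' = (1 - Z) S]. *)
Lemma tr_Seifert_bar :
  \tr (nceval Phi (Xmx d) (Zmx A)) = - ncbar (\tr (nceval Phi (Xmx d) (Zmx A))).
Proof.
have uS := Sei_unit; apply: (tr_nceval_Phi_bar Sei_block_diagonal (mulmxV uS)).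
set S := A - A^T in uS *.
have St : S^T = - S by rewrite /S linearB /= trmxK opprB.
have SVt : S *m (invmx S)^T = - 1%:M.
  by rewrite -[S in S *m _]opprK -St mulNmx -trmx_mul mulVmx // trmx1.
rewrite trmx_mul mulmxA SVt mulNmx mul1mx mulmxBl mul1mx mulmxKV //.
by rewrite /S addrAC subrr sub0r.
Qed.

End Sei.

(** * The matrix I_1/2 *)

Section Half.
Context {n : nat} {d : 'I_n -> nat}.
Local Notation N := (\sum_i d i)%N.
Context (d_even : forall i, ~~ odd (d i)).

(** The diagonal of [I_1/2]. *)
Definition half_row : 'rV[int]_N :=
  \row_p ((d (tagnat.sig1 p))./2 <= tagnat.sig2 p)%:R.

Lemma IhalfE : Ihalf d = intmx (diag_mx half_row).
Proof.
rewrite /intmx map_diag_mx /Ihalf -diag_mxrow; congr diag_mx.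
by apply/rowP => p; rewrite !mxE natz.
Qed.

(** Reversing the order inside each block exchanges the two halves of an even
    block. *)
Definition block_rev (p : 'I_N) : 'I_N := tagnat.Rank _ (rev_ord (tagnat.sig2 p)).

Lemma sig1_block_rev p : tagnat.sig1 (block_rev p) = tagnat.sig1 p.
Proof. exact: tagnat.Rank1K. Qed.

Lemma sig2_block_rev p :
  tagnat.sig2 (block_rev p) = (d (tagnat.sig1 p) - (tagnat.sig2 p).+1)%N :> nat.
Proof. by rewrite tagnat.Rank2K. Qed.

Lemma block_revK : involutive block_rev.
Proof.
move=> p; apply/val_inj/eqP; rewrite -[in X in _ == X](tagnat.sig2K p).
rewrite tagnat.eq_Rank; apply/andP; split; first by rewrite sig1_block_rev.
rewrite /= sig2_block_rev sig1_block_rev.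
by rewrite -subSn // subSS subKn // ltnW.
Qed.

Lemma half_row_rev p : half_row 0 (block_rev p) = 1 - half_row 0 p.
Proof.
rewrite !mxE sig2_block_rev sig1_block_rev.
have := ltn_ord (tagnat.sig2 p); move: (nat_of_ord (tagnat.sig2 p)) => k.
have := odd_double_half (d (tagnat.sig1 p)); rewrite (negPf (d_even _)) add0n.
move: (_./2) => m <- km; rewrite leq_subRL // -addnn leq_add2r.
by rewrite ltnNge; case: leqP.
Qed.

(** The permutation matrix of the block reversal is the intertwiner. *)
Lemma tr_half_bar :
  \tr (nceval Phi (Xmx d) (Ihalf d)) = - ncbar (\tr (nceval Phi (Xmx d) (Ihalf d))).
Proof.
pose S : 'M[int]_N := \matrix_(p, q) (block_rev p == q)%:R.
rewrite IhalfE; apply: (@tr_nceval_Phi_bar _ _ _ S S).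
- move=> p q pq; rewrite mxE; case: eqP => // pq'.
  by rewrite -pq' sig1_block_rev eqxx in pq.
- apply/matrixP => p q; rewrite !mxE (bigD1 (block_rev p)) //= !mxE eqxx mul1r.
  rewrite block_revK [X in _ + X]big1 ?addr0 // => r rp; rewrite !mxE eq_sym (negPf rp).
  by rewrite mul0r.
rewrite tr_diag_mx -diag_const_mx -raddfB /=; apply/matrixP => p q.
rewrite mul_mx_diag mul_diag_mx !mxE.
case: eqP => [<-|_]; last by rewrite mul0r mulr0.
by rewrite mul1r mulr1; have := half_row_rev p; rewrite !mxE.
Qed.

End Half.

Unset Implicit Arguments.
Set Strict Implicit.

Theorem proposition1p7 (R : realType) (n : nat) (L : flink R n)
    (d : 'I_n -> nat) (A : 'M[int]_(\sum_i d i)) :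
  seifert_matrix L A -> chi Phi A = - ncbar (chi Phi A).
Proof.
move=> [SeiA _]; rewrite /chi linearB raddfB /= opprD opprK.
by rewrite -(tr_Seifert_bar SeiA) {1}(tr_half_bar (Sei_even SeiA)) opprK.
Qed.
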